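(* Let $d\ge2$, $\mathsf p\in\mathbb{S}^d$ and $a\in(0,\pi/2)$. If $K\in\overline{\mathcal{K}}^d_{\mathsf p}$ satisfies $r_{\mathsf p}(K)\ge a$, then $$\widetilde U_{\mathsf p}(K)\ge\widetilde U_{\mathsf p}(B_s(\mathsf p,a))=\sigma_d^\circ(B_s(\mathsf p,2a)),$$ with equality if and only if $K=B_s(\mathsf p,a)$. Furthermore, there is a constant $\tilde\beta_\circ>0$ depending only on $a,d$ such that for all $\varepsilon\in(0,1]$ and all $K\in\overline{\mathcal{K}}^d_{\mathsf p}$ with $r_{\mathsf p}(K)\ge a$ and $\vartheta_{\mathsf p}(K)\ge\varepsilon$, $$\widetilde U_{\mathsf p}(K)\ge\left(1+\tilde\beta_\circ\,\varepsilon^{\frac{d+1}{2}}\right)\widetilde U_{\mathsf p}(B_s(\mathsf p,a)).$$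
   Context: $\mathbb{S}^d$ is the unit sphere in $\mathbb{R}^{d+1}$ ($d\ge2$), $\sigma_d^\circ$ its normalized (probability) spherical Lebesgue measure, $B_s(x,r)$ the closed geodesic ball with centre $x$ and radius $r\le\pi$. A spherically convex body is the intersection of $\mathbb{S}^d$ with a closed convex cone in $\mathbb{R}^{d+1}$ that is not a linear subspace; $\overline{\mathcal{K}}^d_{\mathsf p}$ is the set of spherically convex bodies $K$ with $\mathsf p\in K\subset B_s(\mathsf p,\pi/2)$. For $K\in\overline{\mathcal{K}}^d_{\mathsf p}$: $$\widetilde U_{\mathsf p}(K)=\int_{\mathbb{S}^d}\mathbf 1\{(x-\mathsf p)^\perp\cap K\neq\emptyset\}\,\sigma_d^\circ(dx),$$ $r_{\mathsf p}(K)=\max\{r\ge0:B_s(\mathsf p,r)\subset K\}$, $R_{\mathsf p}(K)=\min\{r\ge0:K\subset B_s(\mathsf p,r)\}$, and $\vartheta_{\mathsf p}(K)=R_{\mathsf p}(K)-r_{\mathsf p}(K)$. *)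

(* Defs.v *)
From HB Require Import structures.
From mathcomp Require Import all_boot all_order all_algebra.
From mathcomp Require Import all_classical all_reals all_analysis.
From mathcomp Require Import measurable_realfun.

Set Implicit Arguments.
Unset Strict Implicit.
Unset Printing Implicit Defensive.

Import Order.TTheory GRing.Theory Num.Theory.
Import numFieldNormedType.Exports.

Local Open Scope classical_set_scope.
Local Open Scope ring_scope.

(* The library puts no measurable structure on row vectors; we equip R^n with
   the sigma-algebra generated by the coordinates, i.e. the Borel sets. *)
Section measurable_rV.
Context {R : realType} (n : nat).

Let coor : 'I_n -> 'rV[R]_n -> measurableTypeR R := fun i v => v ord0 i.

Let rV_set0 : g_sigma_preimage coor set0.
Proof. exact: sigma_algebra0. Qed.

Let rV_setC A : g_sigma_preimage coor A -> g_sigma_preimage coor (~` A).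
Proof. exact: sigma_algebraC. Qed.

Let rV_bigcup (F : _^nat) : (forall i, g_sigma_preimage coor (F i)) ->
  g_sigma_preimage coor (\bigcup_i (F i)).
Proof. exact: sigma_algebra_bigcup. Qed.

HB.instance Definition _ :=
  @isMeasurable.Build default_measure_display
    'rV[R]_n (g_sigma_preimage coor) rV_set0 rV_setC rV_bigcup.

Lemma measurable_coord (i : 'I_n) :
  measurable_fun [set: 'rV[R]_n] (fun v : 'rV[R]_n => v ord0 i).
Proof.
move=> _ Y mY; rewrite setTI; apply: sub_sigma_algebra => /=.
rewrite -bigcup_seq/=; exists i => /=; first by rewrite mem_index_enum.
by exists Y => //; rewrite setTI.
Qed.

Lemma measurable_fun_rVP d (T : measurableType d) (f : T -> 'rV[R]_n) :
  (forall i, measurable_fun [set: T] (fun x => f x ord0 i)) ->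
  measurable_fun [set: T] f.
Proof.
move=> mf _ A mA; rewrite setTI; move: A mA.
suff: g_sigma_preimage (fun i => coor i \o f) `<=` @measurable _ T.
  rewrite g_sigma_preimage_comp => + A mA; apply.
  by exists A => //; rewrite setTI.
apply: smallest_sub; first exact: sigma_algebra_measurable.
move=> B; rewrite -bigcup_seq => -[i _ [C mC <-]].
exact: mf.
Qed.

End measurable_rV.

Section lebesgue_rV.
Context {R : realType}.

Definition cons_rV n (p : R * 'rV[R]_n) : 'rV[R]_n.+1 := row_mx p.1%:M p.2.

Lemma measurable_cons_rV n : measurable_fun [set: R * 'rV[R]_n] (@cons_rV n).
Proof.
apply: measurable_fun_rVP => i.
have [j ->|j ->] := @split_ordP 1 n i.
  rewrite (_ : (fun _ => _) = fst)//; apply/funext => p.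
  by rewrite /cons_rV (@row_mxEl _ 1 1 n) !ord1 mxE eqxx.
rewrite (_ : (fun _ => _) = (fun v : 'rV[R]_n => v ord0 j) \o snd).
  by apply: measurableT_comp => //; exact: measurable_coord.
by apply/funext => p; exact: row_mxEr.
Qed.

Section lebesgue_cons.
Context n (mu : {measure set 'rV[R]_n -> \bar R}).

(* The product lebesgue_measure * mu on R^(1 + n); \x^ is the library's product
   measure that does not require mu to be bundled as sigma-finite. *)
Definition lebesgue_cons :=
  pushforward (lebesgue_measure \x^ mu)%E (@cons_rV n).

HB.instance Definition _ := Measure.copy lebesgue_cons
  (measure_function_pushforward__canonical__measure_function_Measure
    (lebesgue_measure \x^ mu)%E (@measurable_cons_rV n)).

End lebesgue_cons.

Fixpoint lebesgue_rV n : {measure set 'rV[R]_n -> \bar R} :=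
  match n with
  | 0 => \d_(0 : 'rV[R]_0)
  | m.+1 => lebesgue_cons (lebesgue_rV m)
  end.

End lebesgue_rV.

Section euclidean.
Context {R : realType} (n : nat).
Implicit Types u v p x y : 'rV[R]_n.

Definition dot u v : R := \sum_(i < n) u ord0 i * v ord0 i.

(* The library norm `|v| on row vectors is the sup norm. *)
Definition enorm v : R := Num.sqrt (dot v v).

Definition orthogonal u : set 'rV[R]_n := [set y | dot u y = 0].

Definition sphere : set 'rV[R]_n := [set x | enorm x = 1].

Definition unit_ball : set 'rV[R]_n := [set x | enorm x <= 1].

Definition direction v : 'rV[R]_n := (enorm v)^-1 *: v.

Lemma measurable_enorm : measurable_fun [set: 'rV[R]_n] enorm.
Proof.
apply: (@measurableT_comp _ _ _ _ _ _ (@Num.sqrt R)).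
  by apply: continuous_measurable_fun; exact: sqrt_continuous.
by apply: measurable_sum => i; apply: measurable_funM; exact: measurable_coord.
Qed.

Lemma measurable_unit_ball : measurable unit_ball.
Proof.
rewrite (_ : unit_ball = [set: 'rV[R]_n] `&` enorm @^-1` `]-oo, 1]).
  exact: measurable_enorm.
by rewrite setTI; apply/seteqP; split => x; rewrite /= in_itv.
Qed.

Lemma measurable_direction : measurable_fun [set: 'rV[R]_n] direction.
Proof.
apply: measurable_fun_rVP => i.
rewrite (_ : (fun _ => _) =
    (fun x : 'rV[R]_n => enorm x `^ (-1) * x ord0 i)); last first.
  by apply/funext => x; rewrite /direction mxE powR_inv1// sqrtr_ge0.
apply: measurable_funM; last exact: measurable_coord.
exact: (measurableT_comp (measurable_powR _) measurable_enorm).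
Qed.

Definition cone_measure :=
  pushforward (mrestr (lebesgue_rV n) measurable_unit_ball) direction.

HB.instance Definition _ := Measure.copy cone_measure
  (measure_function_pushforward__canonical__measure_function_Measure
    (mrestr (lebesgue_rV n) measurable_unit_ball) measurable_direction).

(* Normalized spherical Lebesgue measure, carried by the sphere of R^n (n >= 1):
   sigma A = lebesgue {x in B | x / |x| \in A} / lebesgue B with B the unit ball.
   The Dirac mass is the default value mnormalize requires for measures of total
   mass 0 or +oo; it is irrelevant here since 0 < lebesgue B < +oo. *)
Definition sphere_prob : probability 'rV[R]_n R :=
  mnormalize cone_measure \d_(0 : 'rV[R]_n).

Definition geodesic_dist x y : R := acos (dot x y).

Definition spherical_ball x (r : R) : set 'rV[R]_n :=
  [set y | sphere y /\ geodesic_dist x y <= r].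

Definition convex_cone (C : set 'rV[R]_n) :=
  [/\ C 0, convex_set C & forall (t : R) x, 0 <= t -> C x -> C (t *: x)].

Definition linear_subspace (C : set 'rV[R]_n) :=
  exists U : {vspace 'rV[R]_n}, C = [set x | x \in U].

Definition spherically_convex_body (K : set 'rV[R]_n) :=
  exists C : set 'rV[R]_n,
    [/\ closed C, convex_cone C, ~ linear_subspace C & K = sphere `&` C].

Definition convex_body_around p (K : set 'rV[R]_n) :=
  [/\ spherically_convex_body K, K p & K `<=` spherical_ball p (pi / 2)].

Definition Utilde p (K : set 'rV[R]_n) : \bar R :=
  (\int[sphere_prob]_(x in sphere)
     (\1_[set z | orthogonal (z - p) `&` K !=set0] x)%:E)%E.

(* For K as in convex_body_around, K is compact and the supremum (resp. infimum)
   below is over a nonempty set and attained, i.e. a maximum (resp. minimum). *)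
Definition inner_radius p (K : set 'rV[R]_n) : R :=
  sup [set r | 0 <= r <= pi /\ spherical_ball p r `<=` K].

Definition outer_radius p (K : set 'rV[R]_n) : R :=
  inf [set r | 0 <= r <= pi /\ K `<=` spherical_ball p r].

Definition radius_gap p (K : set 'rV[R]_n) : R :=
  outer_radius p K - inner_radius p K.

End euclidean.
Arguments sphere {R n}.
Arguments sphere_prob {R n}.

(* Main.v *)
(* By convexity a point x of the sphere satisfies (x - p)^perp /\ K != 0 as soon
   as x.y >= p.y for some y in K, so the set measured by Utilde is the union of
   the balls of centre y in K passing through p. For K = B(p, a) this union is
   B(p, 2a). If K contains B(p, a) and a point y at distance at least a + eps
   from p, the union also contains the lune of points of the ball around y
   through p that lie outside B(p, 2a). The lune has thickness of order eps in
   one direction, hence width of order sqrt eps in the d - 1 others, and measure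
   at least c eps^((d+1)/2). Since lebesgue_rV is a product in a fixed basis,
   this last bound is obtained without rotations, by a pigeonhole argument that
   only uses translation invariance: cut a cube successively into thin slices. *)
Require Import Defs.
From HB Require Import structures.
From mathcomp Require Import all_boot all_order all_algebra.
From mathcomp Require Import all_classical all_reals all_analysis.
From mathcomp Require Import measurable_realfun ring lra.
Import Order.TTheory GRing.Theory Num.Theory.
Import numFieldNormedType.Exports.
Set Implicit Arguments.
Unset Strict Implicit.
Unset Printing Implicit Defensive.
Local Open Scope classical_set_scope.
Local Open Scope ring_scope.

(** * Lebesgue measure on row vectors: translation invariance and cubes *)

Section lebesgue_rV_theory.
Context {R : realType}.

(** Uniqueness of Lebesgue measure: the pushforward under the translation gives half-open intervals
    their length. *)
Lemma lebesgue_measure_shift (c : R) (A : set (measurableTypeR R)) :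
  measurable A ->
  lebesgue_measure [set x : measurableTypeR R | A (x + c)] = lebesgue_measure A.
Proof.
move=> mA.
have mc : measurable_fun [set: measurableTypeR R]
    ((fun x => x + c) : measurableTypeR R -> measurableTypeR R).
  by apply: measurable_funD => //; exact: measurable_cst.
rewrite -[LHS]/(pushforward lebesgue_measure
  ((fun x => x + c) : measurableTypeR R -> measurableTypeR R) A).
apply/esym.
pose mu := measure_function_pushforward__canonical__measure_function_Measure
    (@lebesgue_measure R) mc.
apply: (lebesgue_measure_unique (mu := mu)) => //= _ [[u v]] _ <-.
rewrite /pushforward.
rewrite (_ : _ @^-1` _ = `]u - c, v - c]%classic); last first.
  by apply/seteqP; split => x /=; rewrite !in_itv/= ltrBlDr lerBrDr.
rewrite !lebesgue_measure_itv/= !lte_fin ltrD2r.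
by case: ifP => // _; rewrite -!EFinB; congr (_%:E); ring.
Qed.

Lemma cons_rV_ord0 n (p : R * 'rV[R]_n) : cons_rV p ord0 ord0 = p.1.
Proof.
rewrite /cons_rV (_ : ord0 = lshift n (ord0 : 'I_1)); last exact/val_inj.
by rewrite (@row_mxEl _ 1 1 n) !ord1 mxE eqxx.
Qed.

Lemma cons_rV_lift n (p : R * 'rV[R]_n) (j : 'I_n) :
  cons_rV p ord0 (lift ord0 j) = p.2 ord0 j.
Proof.
rewrite /cons_rV (_ : lift ord0 j = rshift 1 j); last exact/val_inj.
by rewrite (@row_mxEr _ 1 1 n).
Qed.

Lemma cons_rVD n (p q : R * 'rV[R]_n) :
  cons_rV p + cons_rV q = cons_rV (p.1 + q.1, p.2 + q.2).
Proof.
apply/rowP => i; rewrite mxE.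
have [j ->|->] := unliftP ord0 i; first by rewrite !cons_rV_lift mxE.
by rewrite !cons_rV_ord0.
Qed.

Lemma cons_rVE n (v : 'rV[R]_n.+1) :
  v = cons_rV (v ord0 ord0, \row_(j < n) v ord0 (lift ord0 j)).
Proof.
apply/rowP => i; have [j ->|->] := unliftP ord0 i.
  by rewrite cons_rV_lift mxE.
by rewrite cons_rV_ord0.
Qed.

Lemma measurable_shift n (c : 'rV[R]_n) :
  measurable_fun [set: 'rV[R]_n] (fun x => x + c).
Proof.
apply: measurable_fun_rVP => i.
rewrite (_ : (fun _ => _) = (fun x : 'rV[R]_n => x ord0 i + c ord0 i)).
  by apply: measurable_funD => //; exact: measurable_coord.
by apply/funext => x; rewrite mxE.
Qed.

Lemma measurable_preshift n (c : 'rV[R]_n) (A : set 'rV[R]_n) :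
  measurable A -> measurable [set x | A (x + c)].
Proof. by move=> mA; rewrite -[X in measurable X]setTI; exact: measurable_shift. Qed.

Lemma ysection_cons_rV n (A : set 'rV[R]_n.+1) (y : 'rV[R]_n) :
  ysection (@cons_rV R n @^-1` A) y = [set x | A (cons_rV (x, y))].
Proof. by apply/seteqP; split => x; rewrite /ysection /= ?inE// => /set_mem. Qed.

Lemma measurable_preimage_cons_rV n (A : set 'rV[R]_n.+1) : measurable A ->
  measurable (@cons_rV R n @^-1` A).
Proof.
by move=> mA; rewrite -[X in measurable X]setTI; exact: measurable_cons_rV.
Qed.

Lemma lebesgue_rVS n (A : set 'rV[R]_n.+1) :
  lebesgue_rV n.+1 A = (\int[lebesgue_rV n]_y
    lebesgue_measure [set x : measurableTypeR R | A (cons_rV (x, y))])%E.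
Proof. by apply: eq_integral => y _ /=; rewrite ysection_cons_rV. Qed.

Lemma measurable_fun_lebesgue_section n (A : set 'rV[R]_n.+1) : measurable A ->
  measurable_fun [set: 'rV[R]_n] (fun y =>
    lebesgue_measure [set x : measurableTypeR R | A (cons_rV (x, y))]).
Proof.
move=> mA.
rewrite (_ : (fun _ => _) = lebesgue_measure \o ysection (@cons_rV R n @^-1` A)).
  apply: measurable_fun_ysection; rewrite ?inE.
  exact: measurable_preimage_cons_rV.
by apply/funext => y /=; rewrite ysection_cons_rV.
Qed.

(** Induction on the dimension: one-dimensional invariance handles each section in the first
    coordinate, and the integral over the remaining ones is unchanged because the shifted measure
    equals [lebesgue_rV n] by the induction hypothesis. *)
Lemma lebesgue_rV_shift n (c : 'rV[R]_n) (A : set 'rV[R]_n) : measurable A ->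
  lebesgue_rV n [set x | A (x + c)] = lebesgue_rV n A.
Proof.
elim: n c A => [c A mA|n IH c A mA].
  by congr (lebesgue_rV 0 _); apply/funext => x /=; rewrite !(thinmx0 (_ + _)) (thinmx0 x).
rewrite !lebesgue_rVS.
set c' : 'rV[R]_n := \row_(j < n) c ord0 (lift ord0 j).
pose g (y : 'rV[R]_n) := lebesgue_measure [set x : measurableTypeR R | A (cons_rV (x, y))].
transitivity (\int[lebesgue_rV n]_y g ((y : 'rV[R]_n) + c')%R)%E.
  apply: eq_integral => y _; rewrite /g.
  rewrite -[RHS](lebesgue_measure_shift (c ord0 ord0)); last first.
    rewrite -ysection_cons_rV; apply: measurable_ysection.
    exact: measurable_preimage_cons_rV.
  congr (lebesgue_measure _); apply/funext => x /=.
  by rewrite {1}(cons_rVE c) cons_rVD.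
pose mu := measure_function_pushforward__canonical__measure_function_Measure
    (lebesgue_rV n) (measurable_shift c').
transitivity (\int[mu]_y g y)%E.
  rewrite [RHS](ge0_integral_pushforward (measurable_shift c'))//.
  exact: measurable_fun_lebesgue_section.
by apply: eq_measure_integral => B mB _; exact: IH.
Qed.

(** Sup-norm balls stand in for Euclidean ones: the product measure gives their volume at once, and
    differences of their points are easily controlled. *)
Definition cube n (r : R) : set 'rV[R]_n := [set x | forall i, `|x ord0 i| <= r].

Lemma measurable_cube n r : measurable (@cube n r).
Proof.
rewrite (_ : cube r = \bigcap_(k in [set: nat])
   [set x : 'rV[R]_n | forall i : 'I_n, k = i -> `|x ord0 i| <= r]).
  apply: bigcapT_measurable => k.
  have [kn|kn] := ltnP k n; last first.
    rewrite (_ : [set _ | _] = setT)//; apply/seteqP; split => // x _ /= i ki.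
    by move: kn; rewrite ki leqNgt ltn_ord.
  rewrite (_ : [set _ | _] = [set: 'rV[R]_n] `&`
    (fun v : 'rV[R]_n => v ord0 (Ordinal kn)) @^-1` `[- r, r]).
    exact: measurable_coord.
  rewrite setTI; apply/seteqP; split => x /=; rewrite in_itv/= -ler_norml; first exact.
  by move=> h i ki; rewrite (_ : i = Ordinal kn)//; apply/val_inj.
apply/seteqP; split => [x h k _ i _|x h i]; first exact: h.
exact: (h i I i).
Qed.

Lemma lebesgue_rV_cube n (r : R) : 0 <= r ->
  lebesgue_rV n (@cube n r) = ((2 * r) ^+ n)%:E.
Proof.
move=> r0; elim: n => [|n IH].
  by rewrite expr0 /= diracE mem_set// => -[].
rewrite lebesgue_rVS.
transitivity (\int[lebesgue_rV n]_y ((2 * r)%:E * (\1_(@cube n r) (y : 'rV[R]_n))%:E))%E.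
  apply: eq_integral => y _; rewrite indicE.
  have [/set_mem yr|/negP yr] := boolP (y \in _).
    rewrite mule1 (_ : [set _ | _] = `[-r, r]%classic); last first.
      apply/seteqP; split => x /=; rewrite in_itv/= -ler_norml.
        by move=> /(_ ord0); rewrite cons_rV_ord0.
      move=> xr i; have [j ->|->] := unliftP ord0 i.
        by rewrite cons_rV_lift; exact: yr.
      by rewrite cons_rV_ord0.
    rewrite lebesgue_measure_itv/= lte_fin; case: ltP => h.
      by rewrite -EFinB; congr (_%:E); ring.
    by congr (_%:E); lra.
  rewrite mule0 (_ : [set _ | _] = set0) ?measure0//.
  rewrite -subset0 => x /= h; apply: yr; rewrite inE => j.
  by have := h (lift ord0 j); rewrite cons_rV_lift.
rewrite ge0_integralZl//; last 2 first.
- by apply/measurable_EFinP; apply: measurable_indic; exact: measurable_cube.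
- by rewrite lee_fin; lra.
by rewrite integral_indic ?setIT; [rewrite IH -EFinM exprS| |exact: measurable_cube].
Qed.

End lebesgue_rV_theory.

(** * Algebra and elementary bounds for the scalar product *)

Section dot_theory.
Context {R : realType} (n : nat).
Implicit Types u v w z : 'rV[R]_n.

Lemma dotC u v : dot u v = dot v u.
Proof. by apply: eq_bigr => i _; rewrite mulrC. Qed.

Lemma dotDl u v w : dot (u + v) w = dot u w + dot v w.
Proof. by rewrite -big_split/=; apply: eq_bigr => i _; rewrite mxE mulrDl. Qed.

Lemma dotZl (k : R) u w : dot (k *: u) w = k * dot u w.
Proof. by rewrite mulr_sumr; apply: eq_bigr => i _; rewrite mxE mulrA. Qed.

Lemma dotNl u w : dot (- u) w = - dot u w.
Proof. by rewrite -scaleN1r dotZl mulN1r. Qed.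

Lemma dotBl u v w : dot (u - v) w = dot u w - dot v w.
Proof. by rewrite dotDl dotNl. Qed.

Lemma dotDr u v w : dot w (u + v) = dot w u + dot w v.
Proof. by rewrite dotC dotDl !(dotC w). Qed.

Lemma dotZr (k : R) u w : dot w (k *: u) = k * dot w u.
Proof. by rewrite dotC dotZl (dotC w). Qed.

Lemma dotBr u v w : dot w (u - v) = dot w u - dot w v.
Proof. by rewrite dotC dotBl !(dotC w). Qed.

Lemma dotNr u w : dot w (- u) = - dot w u.
Proof. by rewrite dotC dotNl (dotC w). Qed.

Definition dotE := (dotDl, dotDr, dotNl, dotNr, dotZl, dotZr).

Lemma dot_delta i w : dot (delta_mx ord0 i) w = w ord0 i.
Proof.
rewrite /dot (bigD1 i)//= mxE !eqxx mul1r big1 ?addr0// => j ji.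
by rewrite mxE (negbTE ji) andbF mul0r.
Qed.

Lemma dot_ge0 u : 0 <= dot u u.
Proof. by apply: sumr_ge0 => i _; rewrite -expr2 sqr_ge0. Qed.

Lemma sqr_coord_le_dot u i : u ord0 i ^+ 2 <= dot u u.
Proof.
rewrite /dot (bigD1 i)//= -expr2 lerDl.
by apply: sumr_ge0 => j _; rewrite -expr2 sqr_ge0.
Qed.

Lemma measurable_dot c : measurable_fun [set: 'rV[R]_n] (dot c).
Proof.
by apply: measurable_sum => i; apply: measurable_funM => //; exact: measurable_coord.
Qed.

Lemma norm_dot_le (A B : R) u v : 0 <= A ->
  (forall i, `|u ord0 i| <= A) -> (forall i, `|v ord0 i| <= B) ->
  `|dot u v| <= n%:R * (A * B).
Proof.
move=> A0 uA vB; apply: (le_trans (ler_norm_sum _ _ _)).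
apply: (@le_trans _ _ (\sum_(i < n) A * B)); last by rewrite sumr_const card_ord mulr_natl.
by apply: ler_sum => i _; rewrite normrM ler_pM.
Qed.

Lemma cubeB (A B : R) u v : cube A u -> cube B v -> cube (A + B) (u - v).
Proof.
by move=> Au Bv i; rewrite !mxE; apply: (le_trans (ler_normB _ _)); exact: lerD.
Qed.

End dot_theory.

(** * Pigeonhole bounds for the volume of thin slices *)

Section slicing.
Context {R : realType} (n : nat).
Implicit Types (c w : 'rV[R]_n) (S : set 'rV[R]_n).

(* S is cut into at most 2 M / eta + 1 slices on which dot c varies by at most
   eta; a translate of S' covers each of them. *)
Lemma lebesgue_rV_slice c S S' (M eta K : R) :
  measurable S -> measurable S' -> 0 < eta -> 0 <= M ->
  (forall x, S x -> `|dot c x| <= M) ->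
  (forall x y, S x -> S y -> `|dot c (x - y)| <= eta -> S' (x - y)) ->
  2 * M / eta + 2 <= K ->
  (lebesgue_rV n S <= K%:E * lebesgue_rV n S')%E.
Proof.
move=> mS mS' eta0 M0 SM SS' hK.
set N := (Num.truncn (2 * M / eta)).+1.
pose F (k : nat) := S `&` ([set: 'rV[R]_n] `&`
  dot c @^-1` `[k%:R * eta - M, k.+1%:R * eta - M]).
have mF k : measurable (F k) by apply: measurableI => //; exact: measurable_dot.
have SF : S `<=` \big[setU/set0]_(k < N) F k.
  move=> x Sx; rewrite -bigcup_mkord.
  have := SM _ Sx; rewrite ler_norml => /andP[xM1 xM2].
  have q0 : 0 <= (dot c x + M) / eta by apply: divr_ge0; lra.
  exists (Num.truncn ((dot c x + M) / eta)).
    rewrite /= ltnS; apply: le_truncn; rewrite ler_pM2r ?invr_gt0//; lra.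
  split=> //; split=> //=; rewrite in_itv/= lerBlDr lerBrDr.
  have /andP[h1 h2] := truncn_itv q0.
  by move: h1 (ltW h2); rewrite ler_pdivlMr// ler_pdivrMr// => -> ->.
apply: (le_trans (content_subadditive (lebesgue_rV n) (fun k _ => mF k) mS SF)).
apply: (@le_trans _ _ (\sum_(k < N) lebesgue_rV n S')%E).
  apply: lee_sum => k _; have [->|/set0P[z [Sz [_ Fz]]]] := eqVneq (F k) set0.
    by rewrite measure0.
  rewrite -(lebesgue_rV_shift (- z) mS'); apply: le_measure; rewrite ?inE//.
    exact: measurable_preshift.
  move=> x [Sx [_ Fx]]; apply: SS' => //.
  move: Fz Fx; rewrite /= !in_itv/= dotBr ler_norml -natr1 => /andP[a1 a2] /andP[b1 b2].
  by apply/andP; split; lra.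
rewrite (_ : (\sum_(k < N) _)%E = (N%:R%:E * lebesgue_rV n S')%E); last first.
  transitivity (\sum_(k < N) 1%:E * lebesgue_rV n S')%E.
    by apply: eq_bigr => k _; rewrite mul1e.
  by rewrite -ge0_sume_distrl// sumEFin sumr_const card_ord.
apply: lee_wpmul2r => //.
rewrite lee_fin; apply: le_trans hK; rewrite /N -natr1.
have := @truncn_le R (2 * M / eta); rewrite divr_ge0//; last 2 first.
- by rewrite mulr_ge0.
- exact: ltW.
by move=> h; lra.
Qed.

Definition strip (cs : seq 'rV[R]_n) (eta r : R) : set 'rV[R]_n :=
  [set w | cube r w /\ forall c, c \in cs -> `|dot c w| <= eta].

Lemma strip_cons c cs eta r : strip (c :: cs) eta r =
  strip cs eta r `&` ([set: 'rV[R]_n] `&` dot c @^-1` `[- eta, eta]).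
Proof.
rewrite setTI; apply/seteqP; split => w /=; rewrite in_itv/= -ler_norml.
  move=> [wr wcs]; split; last by apply: wcs; rewrite mem_head.
  by split => // e ecs; apply: wcs; rewrite inE ecs orbT.
move=> [[wr wcs] wc]; split=> // e; rewrite inE => /predU1P[->//|]; exact: wcs.
Qed.

Lemma measurable_strip cs eta r : measurable (strip cs eta r).
Proof.
elim: cs => [|c cs IH].
  rewrite (_ : strip _ _ _ = cube r); first exact: measurable_cube.
  by apply/seteqP; split => [w []|w wr].
by rewrite strip_cons; apply: measurableI => //; exact: measurable_dot.
Qed.

(** Slicing once per vector of [cs] costs a factor [K] each time. Passing to differences doubles
    both [eta] and [r], whence the powers of 2; their ratio is unchanged, so the same [K] serves at
    every step. *)
Lemma lebesgue_rV_strip cs (B eta r K : R) : 0 <= B -> 0 < eta -> 0 <= r -> 0 <= K ->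
  (forall c, c \in cs -> cube B c) -> n%:R * B * r / eta + 2 <= K ->
  (lebesgue_rV n (cube r) <= (K ^+ size cs)%:E *
    lebesgue_rV n (strip cs (2 ^+ size cs * eta) (2 ^+ size cs * r)))%E.
Proof.
move=> B0 eta0 r0 K0; elim: cs => [|c cs IH] cB hK.
  rewrite !expr0 mul1e !mul1r; apply: le_measure; rewrite ?inE//.
  - exact: measurable_cube.
  - exact: measurable_strip.
apply: (le_trans (IH _ hK)) => [e ecs|]; first by apply: cB; rewrite inE ecs orbT.
rewrite /= exprSr EFinM -muleA; apply: lee_wpmul2l; first by rewrite lee_fin exprn_ge0.
set k := size cs; have k0 : 0 < 2 ^+ k :> R by rewrite exprn_gt0.
apply: (@lebesgue_rV_slice c _ _ (n%:R * (B * (2 ^+ k * r))) (2 ^+ k.+1 * eta)).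
- exact: measurable_strip.
- exact: measurable_strip.
- by rewrite mulr_gt0// exprn_gt0.
- by rewrite !mulr_ge0// ltW.
- move=> x [xr _]; apply: norm_dot_le => //; apply: cB; exact: mem_head.
- move=> x y [xr xcs] [yr ycs] hxy; split.
    by rewrite exprS (_ : _ * _ = 2 ^+ k * r + 2 ^+ k * r); [exact: cubeB|ring].
  move=> e; rewrite inE => /predU1P[->//|ecs].
  rewrite dotBr; apply: (le_trans (ler_normB _ _)).
  by have := xcs _ ecs; have := ycs _ ecs; rewrite exprS -/k; lra.
- apply: le_trans hK; rewrite lerD2r exprS le_eqVlt; apply/orP; left; apply/eqP.
  by field; rewrite !gt_eqF.
Qed.

End slicing.

(** * Volume of prisms of width s and thickness s^2 *)

Section prism.
Context {R : realType}.

(** For nonzero [z], the orthogonal projection onto the hyperplane normal to [z]. *)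
Definition perp n (z w : 'rV[R]_n) : 'rV[R]_n := w - (dot z w / dot z z) *: z.

(** A box in disguise: long in the direction [z], of width [delta] across it and of thickness [eta]
    along the projection of [y]. The formulation by projections avoids the choice of an orthonormal
    basis. *)
Definition prism n (z y : 'rV[R]_n) (r delta eta : R) : set 'rV[R]_n :=
  [set w | [/\ cube r w, cube delta (perp z w) & `|dot y (perp z w)| <= eta]].

(** The projection is self-adjoint. Conditions on [perp z w] thereby become linear forms in [w], to
    which slicing and measurability apply. *)
Lemma dot_perpC n (z u w : 'rV[R]_n) : dot (perp z u) w = dot u (perp z w).
Proof. by rewrite /perp !dotE (dotC u z); ring. Qed.

Lemma coord_perp n (z w : 'rV[R]_n) i :
  perp z w ord0 i = dot (perp z (delta_mx ord0 i)) w.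
Proof. by rewrite dot_perpC dot_delta. Qed.

Lemma perpB n (z u w : 'rV[R]_n) : perp z (u - w) = perp z u - perp z w.
Proof.
rewrite /perp dotBr mulrBl scalerBl.
by apply/rowP => i; rewrite !mxE; ring.
Qed.

Lemma dot_perp n (z w : 'rV[R]_n) : dot z z != 0 -> dot z (perp z w) = 0.
Proof. by move=> z0; rewrite /perp !dotE; field. Qed.

(** Follows from |z_i z_j| <= z.z. The bound is uniform in [z], and so is the number of slices. *)
Lemma cube_perp_delta n (z : 'rV[R]_n) i : 0 < dot z z ->
  cube 2 (perp z (delta_mx ord0 i)).
Proof.
move=> z0 j; rewrite /perp dotC dot_delta !mxE.
apply: (le_trans (ler_normB _ _)).
rewrite (_ : 2 = 1 + 1)//; apply: lerD.
  by case: (_ && _); rewrite ?normr1 ?normr0.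
rewrite mulrAC normrM normfV [X in _ / X]gtr0_norm// ler_pdivrMr// mul1r.
have := sqr_coord_le_dot z i; have := sqr_coord_le_dot z j.
have := sqr_ge0 (z ord0 i - z ord0 j); have := sqr_ge0 (z ord0 i + z ord0 j).
by rewrite ler_norml => *; apply/andP; split; nra.
Qed.

Lemma measurable_prism n (z y : 'rV[R]_n) r delta eta :
  measurable (prism z y r delta eta).
Proof.
rewrite (_ : prism _ _ _ _ _ =
  strip [seq perp z (delta_mx ord0 i) | i <- enum 'I_n] delta r `&`
  ([set: 'rV[R]_n] `&` dot (perp z y) @^-1` `[- eta, eta])).
  by apply: measurableI; [exact: measurable_strip|exact: measurable_dot].
rewrite setTI; apply/seteqP; split => w /=; rewrite in_itv/= -ler_norml dot_perpC.
  move=> [wr wd wy]; split => //; split => // c /mapP[i _ ->].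
  by rewrite -coord_perp; exact: wd.
move=> [[wr wd] wy]; split => // i; rewrite coord_perp; apply: wd.
by apply/mapP; exists i => //; rewrite mem_enum.
Qed.

(* One coordinate of a vector orthogonal to z is determined by the others;
   solving for the one where z is largest costs only a factor n. *)
Lemma perp_max_coord n (z h : 'rV[R]_n.+1) (i0 : 'I_n.+1) (delta : R) :
  0 < dot z z -> dot z h = 0 -> (forall i, `|z ord0 i| <= `|z ord0 i0|) ->
  (forall i, i != i0 -> `|h ord0 i| <= delta) -> `|h ord0 i0| <= n%:R * delta.
Proof.
move=> zz zh zmax hd.
have zi0 : 0 < `|z ord0 i0|.
  rewrite lt_neqAle normr_ge0 andbT eq_sym; apply/eqP => z0.
  suff : dot z z = 0 by move=> e; rewrite e ltxx in zz.
  rewrite /dot big1// => i _.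
  have : `|z ord0 i| <= 0 by rewrite -z0.
  by rewrite normr_le0 => /eqP ->; rewrite mul0r.
move: zh; rewrite /dot (bigD1 i0)//= => /eqP; rewrite addr_eq0 => /eqP zh.
rewrite -(ler_pM2l zi0) -normrM zh normrN.
apply: (le_trans (ler_norm_sum _ _ _)).
apply: (@le_trans _ _ (\sum_(i < n.+1 | i != i0) `|z ord0 i0| * delta)).
  by apply: ler_sum => i ii0; rewrite normrM ler_pM// hd.
rewrite sumr_const (@eq_card _ _ (predC1 i0))// cardC1 card_ord /=.
by rewrite mulr_natl mulrnAr.
Qed.

(** Slicing a cube by [n] coordinates of the projection costs K1 / s each; one more slicing, along
    [y], brings the size s down to s^2 at cost K2 / s. Hence the power s^(n+1), with a constant
    uniform in [z] and [y]. *)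
Lemma prism_volume n (r c2 c3 : R) : 0 < r -> 0 < c2 -> 0 < c3 ->
  exists2 kappa : R, 0 < kappa &
    forall (z y : 'rV[R]_n.+1) (s : R), 0 < dot z z -> dot y y = 1 -> 0 < s <= 1 ->
      ((kappa * s ^+ n.+1)%:E <=
        lebesgue_rV n.+1 (prism z y r (c2 * s) (c3 * s ^+ 2)))%E.
Proof.
move=> r0 c20 c30.
pose m : R := n.+1%:R; have m0 : 0 < m by rewrite ltr0n.
pose t : R := 2 ^+ n; have t0 : 0 < t by rewrite exprn_gt0.
(* The first [n] slicings enlarge the cube by t = 2^n and the last one by 2, which ends exactly at
   [r]. *)
pose r' := r / (2 * t); have r'0 : 0 < r' by rewrite divr_gt0// mulr_gt0.
pose K1 := 2 * m ^+ 2 * r / c2 + 2.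
pose K2 := m * c2 / c3 + 2.
have K10 : 0 < K1.
  by rewrite /K1 addr_gt0// divr_gt0// !mulr_gt0// ?exprn_gt0.
have K20 : 0 < K2 by rewrite /K2 addr_gt0// divr_gt0// !mulr_gt0.
exists ((2 * r') ^+ n.+1 / (K1 ^+ n * K2)).
  apply: divr_gt0; first by apply: exprn_gt0; exact: mulr_gt0.
  by apply: mulr_gt0 => //; exact: exprn_gt0.
move=> z y s zz yy /andP[s0 s1].
have [i0 _ zmax] : exists2 i0 : 'I_n.+1, true & forall i, `|z ord0 i| <= `|z ord0 i0|.
  case: (@Order.TotalTheory.arg_maxP _ _ _ ord0 xpredT (fun i => `|z ord0 i|) isT) => i _ h.
  by exists i => // j; exact: h.
pose cs := [seq perp z (delta_mx ord0 i) | i <- enum 'I_n.+1 & i != i0].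
have scs : size cs = n.
  rewrite size_map -[RHS]/(n.+1.-1) -[in RHS](card_ord n.+1) -(cardC1 i0).
  by rewrite cardE enumT /enum_mem.
(* After the doublings the sliced coordinates are at most c2 s / (2 m). The factor m pays for the
   omitted coordinate [i0], the factor 2 for the last difference. *)
pose eta := c2 * s / (2 * t * m).
have eta0 : 0 < eta by rewrite divr_gt0// ?mulr_gt0// mulr_gt0.
pose S := strip cs (t * eta) (t * r').
have Sperp w : S w -> cube (c2 * s / 2) (perp z w).
  move=> [_ wcs].
  have hne i : i != i0 -> `|perp z w ord0 i| <= t * eta.
    move=> ii0; rewrite coord_perp; apply: wcs; apply/mapP; exists i => //.
    by rewrite mem_filter ii0 mem_enum.
  have hi0 := perp_max_coord zz (dot_perp w (lt0r_neq0 zz)) zmax hne.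
  have te0 : 0 < t * eta by rewrite mulr_gt0.
  have -> : c2 * s / 2 = (n%:R + 1) * (t * eta).
    by rewrite natr1 -/m /eta; field; rewrite !gt_eqF.
  have n0 : 0 <= n%:R :> R by [].
  move=> i; have [->|/hne] := eqVneq i i0; first by apply: le_trans hi0 _; nra.
  by move=> h; apply: le_trans h _; nra.
have y1 : cube 1 y.
  move=> i; rewrite -(@ler_pXn2r _ 2) ?nnegrE// expr1n real_normK ?num_real//.
  by rewrite -yy; exact: sqr_coord_le_dot.
have h1 : (lebesgue_rV n.+1 (cube r') <= ((K1 / s) ^+ n)%:E * lebesgue_rV n.+1 S)%E.
  rewrite /S /t -[in (K1 / s) ^+ _]scs -[in 2 ^+ n]scs.
  apply: (@lebesgue_rV_strip _ _ cs 2 eta r') => //; [exact: ltW|by rewrite divr_ge0// ltW| |].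
    by move=> c /mapP[i _ ->]; exact: cube_perp_delta.
  (* Since s <= 1, the additive 2 in the slice count is absorbed by 2 / s. *)
  rewrite -/m (_ : m * 2 * r' / eta = (K1 - 2) / s); last first.
    by rewrite /r' /eta /K1; field; rewrite !gt_eqF.
  rewrite -lerBrDl -mulrBl opprB addrCA subrr addr0.
  by rewrite ler_pdivlMr//; lra.
(* On [S] the form dot y (perp z w) is already of order s, so thickness of order s^2 takes only
   about 1 / s slices. *)
have h2 : (lebesgue_rV n.+1 S <= (K2 / s)%:E *
    lebesgue_rV n.+1 (prism z y r (c2 * s) (c3 * s ^+ 2)))%E.
  apply: (@lebesgue_rV_slice _ _ (perp z y) _ _ (m * (1 * (c2 * s / 2))) (c3 * s ^+ 2)).
  - exact: measurable_strip.
  - exact: measurable_prism.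
  - by rewrite mulr_gt0// exprn_gt0.
  - by rewrite !mulr_ge0// ltW.
  - by move=> x Sx; rewrite dot_perpC; apply: norm_dot_le => //; exact: Sperp.
  - move=> u v Su Sv; rewrite dot_perpC => huv; split => //.
      rewrite (_ : r = t * r' + t * r'); first by case: Su Sv => [+ _] [+ _]; exact: cubeB.
      by rewrite /r'; field; rewrite gt_eqF.
    rewrite perpB (_ : c2 * s = c2 * s / 2 + c2 * s / 2); last by field.
    by apply: cubeB; exact: Sperp.
  - rewrite (_ : _ / _ = m * c2 / c3 / s); last by field; rewrite !gt_eqF.
    rewrite ler_pdivlMr// mulrDl mulfVK ?gt_eqF// /K2.
    by lra.
have K1s : (0 <= ((K1 / s) ^+ n)%:E)%E by rewrite lee_fin exprn_ge0// divr_ge0// ltW.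
have := le_trans h1 (lee_wpmul2l K1s h2).
rewrite lebesgue_rV_cube; last exact: ltW.
rewrite muleA -EFinM.
rewrite -lee_pdivrMl; last by rewrite mulr_gt0 ?exprn_gt0 ?divr_gt0.
apply: le_trans.
rewrite -EFinM lee_fin le_eqVlt; apply/orP; left; apply/eqP.
rewrite expr_div_n (exprSr s).
by field; rewrite ?expf_neq0 ?gt_eqF.
Qed.

End prism.

(** * The sphere, its probability measure and spherical balls *)

Section sphere_theory.
Context {R : realType}.

Lemma enormE n (x : 'rV[R]_n) : enorm x ^+ 2 = dot x x.
Proof. by rewrite sqr_sqrtr// dot_ge0. Qed.

Lemma enorm_ge0 n (x : 'rV[R]_n) : 0 <= enorm x.
Proof. exact: sqrtr_ge0. Qed.

Lemma sphereP n (x : 'rV[R]_n) : sphere x <-> dot x x = 1.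
Proof.
rewrite /sphere/= -enormE; split => [->|/eqP]; first by rewrite expr1n.
by rewrite sqrf_eq1 => /orP[/eqP//|/eqP h]; have := enorm_ge0 x; rewrite h; lra.
Qed.

Lemma sphere_direction n (x : 'rV[R]_n) : 0 < dot x x -> sphere (direction x).
Proof.
move=> x0; apply/sphereP; rewrite /direction !dotE -enormE.
by field; rewrite -sqrf_eq0 enormE gt_eqF.
Qed.

Lemma dot_sphere_itv n (x y : 'rV[R]_n) : sphere x -> sphere y -> -1 <= dot x y <= 1.
Proof.
move=> /sphereP xx /sphereP yy; have := dot_ge0 (x - y); have := dot_ge0 (x + y).
by rewrite !dotE xx yy (dotC y x) => *; apply/andP; split; lra.
Qed.

(** Cosine is decreasing on [0, pi], so balls are caps cut out by a linear inequality. *)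
Lemma spherical_ballE n (p : 'rV[R]_n) r : sphere p -> 0 <= r <= pi ->
  spherical_ball p r = [set y | sphere y /\ cos r <= dot p y].
Proof.
move=> p1 r0pi.
suff E y : sphere y -> (geodesic_dist p y <= r) = (cos r <= dot p y).
  by apply/seteqP; split => y [y1]; rewrite -?E// => h; split => //=; rewrite -?E// ?E.
move=> y1; have /andP[h1 h2] := dot_sphere_itv p1 y1.
rewrite -[in RHS](@acosK _ (dot p y)) ?in_itv/= ?h1//.
by rewrite !leNgt ltr_cos// in_itv/= ?acos_ge0 ?acos_lepi ?h1 ?h2.
Qed.

Lemma measurable_dot_ge n (c : 'rV[R]_n) (k : R) : measurable [set x | k <= dot c x].
Proof.
rewrite (_ : [set _ | _] = [set: 'rV[R]_n] `&` dot c @^-1` `[k, +oo[).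
  exact: measurable_dot.
by rewrite setTI; apply/seteqP; split => x /=; rewrite in_itv/= andbT.
Qed.

Lemma measurable_sphere n : measurable (@sphere R n).
Proof.
rewrite (_ : sphere = [set: 'rV[R]_n] `&` @enorm R n @^-1` [set 1]).
  exact: measurable_enorm.
by rewrite setTI.
Qed.

Lemma unit_ball_sub_cube n : @unit_ball R n `<=` cube 1.
Proof.
move=> x x1 i; rewrite -(@ler_pXn2r _ 2) ?nnegrE// expr1n real_normK ?num_real//.
apply: (le_trans (sqr_coord_le_dot x i)); rewrite -enormE.
by rewrite -(expr1n _ 2) ler_pXn2r ?nnegrE// enorm_ge0.
Qed.

Lemma cube_sub_unit_ball n : cube n.+1%:R^-1 `<=` @unit_ball R n.+1.
Proof.
move=> x xc; rewrite /unit_ball/= -(@ler_pXn2r _ 2) ?nnegrE ?enorm_ge0// expr1n enormE.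
apply: (le_trans (ler_norm _)).
apply: (le_trans (norm_dot_le _ xc xc)); first by rewrite invr_ge0.
by rewrite mulrA divff ?mul1r ?pnatr_eq0// invf_le1// ler1n.
Qed.

Lemma cone_measureE n (A : set 'rV[R]_n) :
  cone_measure A = lebesgue_rV n (@direction R n @^-1` A `&` @unit_ball R n).
Proof. by []. Qed.

Lemma cone_measureT n :
  (0 < @cone_measure R n.+1 setT /\ @cone_measure R n.+1 setT <= (2 ^+ n.+1)%:E)%E.
Proof.
rewrite cone_measureE preimage_setT setTI; split.
  apply: (@lt_le_trans _ _ (lebesgue_rV n.+1 (cube n.+1%:R^-1))).
    by rewrite lebesgue_rV_cube// lte_fin exprn_gt0// mulr_gt0// invr_gt0 ltr0n.
  apply: le_measure; rewrite ?inE; last exact: cube_sub_unit_ball.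
  - exact: measurable_cube.
  - exact: measurable_unit_ball.
apply: (@le_trans _ _ (lebesgue_rV n.+1 (cube 1))).
  apply: le_measure; rewrite ?inE; last exact: unit_ball_sub_cube.
  - exact: measurable_unit_ball.
  - exact: measurable_cube.
by rewrite lebesgue_rV_cube// mulr1.
Qed.

(** The cone over [A] in the unit ball contains [P], and the unit ball lies in a cube of volume
    2^(n+1), which bounds the normalizing denominator. *)
Lemma sphere_prob_ge n (A P : set 'rV[R]_n.+1) :
  measurable A -> measurable P -> P `<=` @unit_ball R n.+1 ->
  (forall z, P z -> A (direction z)) ->
  ((2 ^- n.+1)%:E * lebesgue_rV n.+1 P <= sphere_prob A)%E.
Proof.
move=> mA mP P1 PA; have [c0 c2] := @cone_measureT n.
have cfin : @cone_measure R n.+1 setT \is a fin_num.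
  by rewrite ge0_fin_numE ?(le_lt_trans c2) ?ltry.
(* The total mass is positive and finite, which rules out the Dirac default of [mnormalize]. *)
rewrite /sphere_prob /= /mnormalize gt_eqF//= lt_eqF/=; last exact: le_lt_trans c2 (ltry _).
rewrite muleC; apply: lee_pmul; [exact: measure_ge0|by rewrite lee_fin invr_ge0 exprn_ge0| |].
  rewrite -[leRHS]/(lebesgue_rV n.+1 (@direction R n.+1 @^-1` A `&` @unit_ball R n.+1)).
  apply: le_measure; rewrite ?inE//.
    apply: measurableI; last exact: measurable_unit_ball.
    by rewrite -[X in measurable X]setTI; exact: measurable_direction.
  by move=> z Pz; split; [exact: PA|exact: P1].
rewrite lee_fin lef_pV2 ?posrE ?exprn_gt0//; last first.
  by rewrite fine_gt0// c0 (le_lt_trans c2) ?ltry.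
by rewrite -lee_fin fineK.
Qed.

(** The integral of a nonnegative function is a supremum over the simple functions below it, and the
    indicator of [A] is one of them; measurability is thus asked of [A] only. *)
Lemma Utilde_ge n (p : 'rV[R]_n) (A K : set 'rV[R]_n) : measurable A -> A `<=` sphere ->
  (forall x, A x -> Defs.orthogonal (x - p) `&` K !=set0) ->
  (sphere_prob A <= Utilde p K)%E.
Proof.
move=> mA A1 AK; rewrite /Utilde ge0_integralE => [|x _]; last by rewrite lee_fin.
apply: ereal_sup_ubound; exists (indic_nnsfun R mA).
  move=> x /=; rewrite -[mindic R mA x]/(\1_A x) patchE.
  case: ifPn => [_|/negP xS].
    rewrite lee_fin !indicE; case: (boolP (x \in A)) => [/set_mem Ax|_]//.
    by rewrite [X in _ <= (nat_of_bool X)%:R]mem_set//; exact: AK.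
  rewrite lee_fin indicE memNset// => Ax; apply: xS; rewrite inE; exact: A1.
exact: sintegral_indic.
Qed.

Lemma meets_spherical_ball n (p x : 'rV[R]_n) (a : R) : sphere p -> sphere x ->
  0 < a < pi / 2 ->
  Defs.orthogonal (x - p) `&` spherical_ball p a !=set0 <-> spherical_ball p (2 * a) x.
Proof.
move=> p1 x1 /andP[a0 api].
have pi0 := pi_gt0 R.
rewrite !spherical_ballE//; try by apply/andP; split; lra.
have ca : 0 < cos a by apply: cos_gt0_pihalf; apply/andP; split; lra.
have -> : cos (2 * a) = 2 * cos a ^+ 2 - 1.
  by rewrite mulr_natl cos_mulr2n mulr_natl.
have /sphereP pp := p1; have /sphereP xx := x1; split.
  move=> [y [/= xy [/sphereP yy ay]]]; split => //.
  (* With t = p.y = x.y, expanding |x + p - 2 t y|^2 >= 0 yields x.p >= 2 t^2 - 1. *)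
  have := dot_ge0 (x + p - (2 * dot p y) *: y).
  move: xy; rewrite /Defs.orthogonal /=.
  rewrite !dotE xx pp yy (dotC p x) (dotC y x) (dotC y p) => xy.
  have -> : dot x y = dot p y by lra.
  by nra.
move=> [_ xp].
have xpp : 0 < dot (x + p) (x + p) by rewrite !dotE xx pp (dotC p x) in xp *; nra.
(* The spherical midpoint of x and p; its scalar product with p is |x + p| / 2, which is at least
   cos a. *)
exists (direction (x + p)); split.
  rewrite /Defs.orthogonal/direction/= dotZr !dotE xx pp (dotC p x).
  by ring.
split; first exact: sphere_direction.
have e0 : 0 < enorm (x + p) by rewrite sqrtr_gt0.
rewrite /direction dotZr mulrC ler_pdivlMr//.
have := enormE (x + p); rewrite !dotE xx pp (dotC p x); rewrite (dotC p x) in xp *.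
set E := enorm _ in e0 *; set D := dot x p in xp *.
move=> EE; have cE : 2 * cos a <= E.
  by rewrite -(@ler_pXn2r _ 2) ?nnegrE ?(ltW e0) ?mulr_ge0 ?(ltW ca)// exprMn; lra.
by rewrite /= in EE xp *; nra.
Qed.

End sphere_theory.

(** * Convex bodies around p and the hyperplanes that meet them *)

Section convex_bodies.
Context {R : realType}.

Lemma dot_eq0 n (z : 'rV[R]_n) : dot z z = 0 -> z = 0.
Proof.
move=> zz; apply/rowP => i; apply/eqP; rewrite mxE -sqrf_eq0 eq_le sqr_ge0 andbT -zz.
exact: sqr_coord_le_dot.
Qed.

Lemma dot_neq0 n (p z : 'rV[R]_n) : dot p z != 0 -> 0 < dot z z.
Proof.
move=> pz; rewrite lt_neqAle dot_ge0 andbT eq_sym; apply: contra_neq pz => /dot_eq0 ->.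
by rewrite /dot big1// => i _; rewrite mxE mulr0.
Qed.

Lemma measurable_spherical_ball n (p : 'rV[R]_n) r : sphere p -> 0 <= r <= pi ->
  measurable (spherical_ball p r).
Proof.
move=> p1 r0pi; rewrite spherical_ballE//.
apply: (@measurableI _ _ sphere [set y | cos r <= dot p y]).
  exact: measurable_sphere.
exact: measurable_dot_ge.
Qed.

Lemma Utilde_spherical_ball n (p : 'rV[R]_n) (a : R) : sphere p -> 0 < a < pi / 2 ->
  Utilde p (spherical_ball p a) = sphere_prob (spherical_ball p (2 * a)).
Proof.
move=> p1 a0pi; have /andP[a0 api] := a0pi.
rewrite /Utilde -[in RHS](@setIidl _ (spherical_ball p (2 * a)) sphere); last by move=> y [].
rewrite -integral_indic; last 2 first.
- exact: measurable_sphere.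
- by apply: measurable_spherical_ball => //; apply/andP; split; lra.
apply: eq_integral => x /set_mem x1; congr (_%:E); rewrite !indicE; congr (_%:R).
congr nat_of_bool; apply/idP/idP => /set_mem h; apply/mem_set.
- by apply/meets_spherical_ball.
- by apply/(meets_spherical_ball p1 x1).
Qed.

Lemma convex_coneD n (C : set 'rV[R]_n) u v : convex_cone C -> C u -> C v -> C (u + v).
Proof.
move=> [_ Cconv Cs] Cu Cv.
have h0 : 0 <= 2^-1 :> R by rewrite invr_ge0.
have h1 : 2^-1 <= 1 :> R by lra.
have := Cconv u v (Itv01 h0 h1) (mem_set Cu) (mem_set Cv).
move=> /set_mem h; have h2 : 0 <= 2 :> R by [].
have := Cs 2 _ h2 h; congr C.
rewrite /conv /= /unstable.onem.
by rewrite scalerDr !scalerA; congr (_ + _); rewrite -[RHS]scale1r; congr (_ *: _); field.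
Qed.

Lemma directionK n (z : 'rV[R]_n) : 0 < dot z z -> enorm z *: direction z = z.
Proof.
move=> z0; rewrite /direction scalerA divff ?scale1r//.
by rewrite -sqrf_eq0 enormE gt_eqF.
Qed.

(* Along the segment from p to y the linear form dot (x - p) changes sign. *)
Lemma convex_body_meets n (p x y : 'rV[R]_n) (K : set 'rV[R]_n) :
  sphere p -> sphere x -> convex_body_around p K -> K y -> dot p y <= dot x y ->
  Defs.orthogonal (x - p) `&` K !=set0.
Proof.
move=> p1 x1 [[C [_ Ccone _ ->]] [_ Cp] Khalf] [y1 Cy] xy.
have [_ _ Cs] := Ccone.
have /andP[_ xp1] := dot_sphere_itv x1 p1.
have py0 : 0 <= dot p y.
  have := Khalf y (conj y1 Cy); rewrite spherical_ballE ?cos_pihalf//; first by case.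
  by have := pi_gt0 R => ?; apply/andP; split; lra.
have /sphereP pp := p1.
have fp : dot (x - p) p <= 0 by rewrite !dotE pp; lra.
have fy : 0 <= dot (x - p) y by rewrite !dotE; lra.
have [fy0|fy0] := eqVneq (dot (x - p) y) 0; first by exists y; split.
pose z := dot (x - p) y *: p - dot (x - p) p *: y.
have fz : dot (x - p) z = 0 by rewrite /z dotDr dotNr !dotZr; ring.
have {}fy : 0 < dot (x - p) y by rewrite lt_neqAle eq_sym fy0.
(* Thus z, a nonnegative combination of p and y, is nonzero and can be projected to the sphere. *)
have pz : 0 < dot p z.
  by rewrite /z dotDr dotNr !dotZr pp mulr1 ltr_pwDl// -mulNr mulr_ge0// oppr_ge0.
have zz : 0 < dot z z by apply: (@dot_neq0 _ p); rewrite gt_eqF.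
exists (direction z); split; first by rewrite /Defs.orthogonal/= dotZr fz mulr0.
split; first exact: sphere_direction.
apply: (Cs); first by rewrite invr_ge0 enorm_ge0.
rewrite /z -scaleNr; apply: convex_coneD => //; apply: Cs => //; first exact: ltW.
by rewrite oppr_ge0.
Qed.

(** As [inner_radius] is a supremum, it directly gives only the points at distance less than [a].
    For l > 0 the direction of y + l p is such a point; letting l tend to 0 and using that the cone
    is closed gives y. *)
Lemma spherical_ball_sub_body n (p : 'rV[R]_n) (K : set 'rV[R]_n) (a : R) :
  sphere p -> 0 < a < pi / 2 -> convex_body_around p K -> a <= inner_radius p K ->
  spherical_ball p a `<=` K.
Proof.
move=> p1 /andP[a0 api] Kp aK y.
have pi0 := pi_gt0 R.
rewrite spherical_ballE//; last by apply/andP; split; lra.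
move=> [y1 ay]; have [[C [Ccl [_ _ Cs] _ KE]] Kpp Khalf] := Kp.
have /sphereP pp := p1; have /sphereP yy := y1.
have ca : 0 < cos a by apply: cos_gt0_pihalf; apply/andP; split; lra.
have ca1 : cos a < 1 by rewrite -[ltRHS]cos0 ltr_cos// in_itv/=; apply/andP; split; lra.
have Cl (l : R) : 0 < l -> C (y + l *: p).
  move=> l0; set z := y + l *: p.
  have zz : dot z z = 1 + 2 * l * dot p y + l ^+ 2.
    by rewrite /z !dotE pp yy (dotC y p); ring.
  have zz0 : 0 < dot z z by rewrite zz; nra.
  have e0 : 0 < enorm z by rewrite sqrtr_gt0.
  have v1 := sphere_direction zz0.
  have /andP[pv1 pv2] := dot_sphere_itv p1 v1.
  have pv : cos a < dot p (direction z).
    rewrite /direction dotZr mulrC ltr_pdivlMr//.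
    rewrite -(@ltr_pXn2r _ 2) ?nnegrE ?mulr_ge0 ?(ltW ca) ?(ltW e0)//; last first.
      by rewrite /z !dotE pp mulr1; lra.
    rewrite exprMn enormE zz /z !dotE pp mulr1.
    (* The two sides differ by (p.y)^2 - cos^2 a + (1 - cos^2 a) (2 l p.y + l^2). *)
    have : 0 < 1 - cos a ^+ 2 by nra.
    have : 0 <= dot p y ^+ 2 - cos a ^+ 2 by nra.
    move=> h1 h2; have h3 : 0 < 2 * l * dot p y + l ^+ 2 by nra.
    by have := mulr_gt0 h3 h2; lra.
  have ra : geodesic_dist p (direction z) < a.
    rewrite -ltr_cos ?acosK ?in_itv/= ?pv1 ?acos_ge0 ?acos_lepi ?pv1//.
    by apply/andP; split; lra.
  have [||r [r0pi rK] dr] := @sup_gt R [set r | 0 <= r <= pi /\ spherical_ball p r `<=` K]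
    (geodesic_dist p (direction z)).
  (* The ball of radius 0 is the single point p, so the set of radii is nonempty. *)
  - exists 0; split; first by rewrite lexx ltW.
    move=> w; rewrite spherical_ballE ?lexx ?ltW// cos0 => -[/sphereP ww pw].
    rewrite (_ : w = p)//; apply/eqP; rewrite -subr_eq0; apply/eqP/dot_eq0/eqP.
    by rewrite eq_le dot_ge0 andbT !dotE ww pp (dotC w p); lra.
  - exact: lt_le_trans ra aK.
  have : K (direction z) by apply: rK; split => //; exact: ltW.
  by rewrite KE => -[_ Cv]; rewrite -(directionK zz0); apply: Cs; first exact: ltW.
rewrite KE; split => //.
apply: (@closed_cvg _ _ ((0 : R)^'+) _ (fun l : R => y + l *: p) C Ccl _ y).
  by near=> l; apply: Cl.
rewrite -[X in _ --> X]addr0 -(scale0r p).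
apply: cvgD; first exact: cvg_cst.
apply: cvgZr_tmp; apply: cvg_at_right_filter; exact: cvg_id.
Unshelve. all: by end_near.
Qed.

End convex_bodies.

(** * Scalar estimates behind the lune *)

Section cap.
Context {R : realType}.

(** Addition formula with cos eps <= 1 and, by the mean value theorem on [0, eps], sin eps >= eps
    cos 1. *)
Lemma cos_add_le (a eps : R) : 0 < a < pi / 2 -> 0 < eps <= 1 ->
  cos (a + eps) <= cos a - sin a * cos 1 * eps.
Proof.
move=> /andP[a0 api] /andP[e0 e1]; have pi0 := pi_gt0 R.
have pi2 : 2 <= pi :> R by exact: pi_ge2.
have ca : 0 < cos a by apply: cos_gt0_pihalf; apply/andP; split; lra.
have sa : 0 < sin a by apply: sin_gt0_pihalf; apply/andP; split; lra.
have [c cI E] := @MVT_segment R sin cos 0 eps (ltW e0)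
  (fun x _ => is_derive_sin x) (continuous_subspaceT (@continuous_sin R)).
move: cI; rewrite in_itv/= => /andP[c0 c1].
have : sin eps >= cos 1 * eps.
  move: E; rewrite sin0 !subr0 => ->; rewrite ler_pM2r// leNgt ltr_cos -?leNgt.
  - exact: le_trans c1 e1.
  - by rewrite in_itv/=; apply/andP; split; lra.
  - by rewrite in_itv/=; apply/andP; split; lra.
rewrite cosD => h; have := cos_le1 eps => h'.
have := ler_wpM2l (ltW sa) h; have := ler_wpM2l (ltW ca) h'.
by lra.
Qed.

Lemma cap_ineq (q lam al rho N E H Y : R) (g := lam * (1 - al ^+ 2) / 2) :
  0 <= q -> 0 <= al < 1 -> 0 < lam <= 1 / 4 -> lam <= 1 - al ^+ 2 ->
  4 * lam <= al ^+ 2 - q ^+ 2 ->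
  0 <= N -> N ^+ 2 = 1 + 2 * q * lam + lam ^+ 2 ->
  1 / 8 <= rho <= 3 / 8 -> 0 <= E -> E ^+ 2 = rho ^+ 2 * N ^+ 2 + H ->
  0 <= H <= g / 128 -> - (g / 64) <= Y <= g / 64 ->
  [/\ 0 < E, E <= 1, q * E <= rho * (q + lam) + Y &
    rho * ((2 * q + lam) * q - 1) + (2 * q + lam) * Y < (2 * al ^+ 2 - 1) * E].
Proof.
move=> q0 /andP[al0 al1] /andP[lam0 lam1] lamb lamq N0 NE /andP[rho0 rho1] E0 EE
  /andP[H0 Hg] /andP[Y0 Y1].
have gE : g = lam * (1 - al ^+ 2) / 2 by [].
clearbody g.
have b0 : 0 < 1 - al ^+ 2 by lra.
have g0 : 0 < g by rewrite gE divr_gt0// mulr_gt0.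
have glam : g <= lam / 2.
  by rewrite gE ler_pM2r ?invr_gt0// ger_pMr//; have := sqr_ge0 al; lra.
have qal : q <= al by rewrite -(@ler_pXn2r _ 2) ?nnegrE//; lra.
have q1 : q <= 1 by lra.
have ql : q * lam <= lam by rewrite ger_pMl.
have ll : lam ^+ 2 <= lam / 4 by rewrite expr2; nra.
have ql0 : 0 <= q * lam by rewrite mulr_ge0// ltW.
have ll0 := sqr_ge0 lam.
have N1 : 1 <= N by rewrite -(@ler_pXn2r _ 2) ?nnegrE// expr1n; lra.
have N2 : N <= 1 + (q * lam + lam ^+ 2 / 2).
  rewrite -(@ler_pXn2r _ 2) ?nnegrE//; last by lra.
  by rewrite NE; have := sqr_ge0 (q * lam + lam ^+ 2 / 2); lra.
have rN : 1 / 8 <= rho * N by nra.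
have rN1 : rho * N <= 1 / 2 by nra.
have E1 : rho * N <= E.
  by rewrite -(@ler_pXn2r _ 2) ?nnegrE//; [rewrite EE exprMn; lra|lra].
(* As rho N >= 1/8, the cross term 8 rho N H of the square already dominates [H]. *)
have E2 : E <= rho * N + 4 * H.
  rewrite -(@ler_pXn2r _ 2) ?nnegrE//; last by lra.
  have h : 1 / 8 * H <= rho * N * H by exact: ler_wpM2r.
  by rewrite EE sqrrD exprMn; have := sqr_ge0 (4 * H); lra.
split; [lra|lra| |].
  have h1 : q * E <= q * (rho * N) + 4 * H.
    have := ler_wpM2l q0 E2; have : q * (4 * H) <= 4 * H by apply: ler_piMl => //; lra.
    by lra.
  (* The slack at h = 0: by [N2] it is at least lam (1 - q^2) - q lam^2 / 2, and lam <= 1 - al^2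
     lets half of lam (1 - al^2) survive. *)
  have h2 : g <= q + lam - q * N.
    have := ler_wpM2l q0 N2.
    have h3 : q * (q * lam) <= al ^+ 2 * lam by rewrite mulrA -expr2 ler_wpM2r//; lra.
    have h4 : q * (lam ^+ 2 / 2) <= lam ^+ 2 / 2 by apply: ler_piMl => //; lra.
    have h5 : lam ^+ 2 <= lam * (1 - al ^+ 2) by rewrite expr2 ler_pM2l.
    by rewrite gE; lra.
  have h3 : 1 / 8 * g <= rho * (q + lam - q * N).
    by apply: ler_pM => //; lra.
  by lra.
have al21 : al ^+ 2 < 1 by lra.
have al20 := sqr_ge0 al.
have h1 : (2 * al ^+ 2 - 1) * (rho * N) - 4 * H <= (2 * al ^+ 2 - 1) * E.
  have : `|(2 * al ^+ 2 - 1) * (E - rho * N)| <= 1 * (4 * H).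
    rewrite normrM; apply: ler_pM => //; rewrite ler_norml; apply/andP; split; lra.
  by rewrite ler_norml => /andP[+ _]; lra.
have h2 : (2 * al ^+ 2 - 1) - (q * lam + lam ^+ 2 / 2) <= (2 * al ^+ 2 - 1) * N.
  have : `|(2 * al ^+ 2 - 1) * (N - 1)| <= 1 * (q * lam + lam ^+ 2 / 2).
    rewrite normrM; apply: ler_pM => //; rewrite ler_norml; apply/andP; split; lra.
  by rewrite ler_norml => /andP[+ _]; lra.
(* The bracket is at least 2 (al^2 - q^2) - 2 q lam - lam^2 / 2, whose first term is at least 8
   lam. *)
have h3 : 1 / 8 * (5 * lam) <= rho * ((2 * al ^+ 2 - 1) * N - ((2 * q + lam) * q - 1)).
  by apply: ler_pM => //; lra.
have h4 : (2 * q + lam) * Y <= 3 * (g / 64).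
  apply: (@le_trans _ _ ((2 * q + lam) * (g / 64))); first by apply: ler_wpM2l => //; lra.
  by apply: ler_wpM2r; lra.
by lra.
Qed.

End cap.

(** * Lower bound for the measure of the lune *)

Section cap_volume.
Context {R : realType}.

Lemma measurable_dot_lt n (c : 'rV[R]_n) (k : R) : measurable [set x | dot c x < k].
Proof.
rewrite (_ : [set _ | _] = ~` [set x | k <= dot c x]).
  by apply: measurableC; exact: measurable_dot_ge.
by apply/seteqP; split => x /=; rewrite ltNge => /negP.
Qed.

Definition lune n (p y : 'rV[R]_n) (k : R) : set 'rV[R]_n :=
  [set x | [/\ sphere x, dot p y <= dot y x & dot p x < k]].

Lemma measurable_lune n (p y : 'rV[R]_n) k : measurable (lune p y k).
Proof.
rewrite (_ : lune _ _ _ = sphere `&`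
    ([set x | dot p y <= dot y x] `&` [set x | dot p x < k])); last first.
  by apply/seteqP; split => x /= => [[]|[? []]].
apply: measurableI; first exact: measurable_sphere.
by apply: measurableI; [exact: measurable_dot_ge|exact: measurable_dot_lt].
Qed.

(* 2 (p . y) y - p is the reflection of p in y: it lies on the boundary of the
   ball around y through p, opposite to p. The term lam y moves it inside. *)
Lemma direction_prism_cap n (p y w : 'rV[R]_n.+1) (lam al c2 c3 s : R)
    (q := dot p y) (m : R := n.+1%:R) (g := lam * (1 - al ^+ 2) / 2)
    (z0 := (2 * q + lam) *: y - p) (z := 4^-1 *: z0 + w) :
  sphere p -> sphere y -> 0 <= q -> 0 <= al < 1 -> 0 < lam <= 1 / 4 ->
  lam <= 1 - al ^+ 2 -> 4 * lam <= al ^+ 2 - q ^+ 2 ->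
  0 <= c2 * s -> m * (c2 * s) ^+ 2 <= g / 128 -> c3 * s ^+ 2 <= g / 64 ->
  prism z0 y (8 * m)^-1 (c2 * s) (c3 * s ^+ 2) w ->
  unit_ball z /\ lune p y (2 * al ^+ 2 - 1) (direction z).
Proof.
move=> /sphereP pp /sphereP yy q0 al01 lam01 lam1 lamq cs0 c2g c3g [wr wd wy].
have m0 : 0 < m by rewrite ltr0n.
set N := enorm z0; set h := perp z0 w in wd wy *.
have lam0 : 0 < lam by case/andP: lam01.
have NE : N ^+ 2 = 1 + 2 * q * lam + lam ^+ 2.
  by rewrite enormE /z0 !dotE pp yy (dotC y p) -/q; ring.
have N0 : 0 <= N by exact: enorm_ge0.
have N1 : 1 <= N.
  rewrite -(@ler_pXn2r _ 2) ?nnegrE// expr1n NE.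
  by have := mulr_ge0 q0 (ltW lam0); have := sqr_ge0 lam; lra.
have zz0 : 0 < dot z0 z0 by rewrite -enormE -/N exprn_gt0//; lra.
set rho := 4^-1 + dot z0 w / dot z0 z0.
have zE : z = rho *: z0 + h.
  by rewrite /z /h /perp /rho scalerDl; apply/rowP => i; rewrite !mxE; ring.
have z0h : dot z0 h = 0 by apply: dot_perp; rewrite gt_eqF.
have z0y : dot y z0 = q + lam by rewrite /z0 !dotE yy (dotC y p) -/q; ring.
have pz0 : dot p z0 = (2 * q + lam) * q - 1 by rewrite /z0 !dotE pp.
(* Since h is orthogonal to z0, it affects p.z only through y.h. This is why thickness of order eps
   is imposed in one direction only; elsewhere h enters through |h|^2, which allows width sqrt
   eps. *)
have ph : dot p h = (2 * q + lam) * dot y h.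
  by move: z0h; rewrite {1}/z0 !dotE; lra.
have z0N : cube N z0.
  move=> i; rewrite -(@ler_pXn2r _ 2) ?nnegrE// real_normK ?num_real// enormE.
  exact: sqr_coord_le_dot.
have rho_itv : 1 / 8 <= rho <= 3 / 8.
  have : `|dot z0 w / dot z0 z0| <= 1 / 8.
    rewrite normf_div (gtr0_norm zz0) ler_pdivrMr//.
    apply: (le_trans (norm_dot_le N0 z0N wr)).
    rewrite -enormE -/N -/m (_ : m * _ = 1 / 8 * N); last by field; rewrite gt_eqF.
    by rewrite ler_wpM2l// expr2 ler_peMr.
  rewrite ler_norml /rho.
  by move=> /andP[? ?]; apply/andP; split; lra.
clearbody h z z0.
have EE : enorm z ^+ 2 = rho ^+ 2 * N ^+ 2 + dot h h.
  rewrite !enormE zE !dotE (dotC h z0) z0h; ring.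
have hh : 0 <= dot h h <= g / 128.
  rewrite dot_ge0/=; apply: le_trans c2g; apply: (le_trans (ler_norm _)).
  by apply: (le_trans (norm_dot_le cs0 wd wd)); rewrite expr2.
have hy : - (g / 64) <= dot y h <= g / 64.
  by rewrite -ler_norml; apply: le_trans wy c3g.
have [E0 E1 Fy Fp] := cap_ineq q0 al01 lam01 lam1 lamq N0 NE rho_itv (enorm_ge0 z) EE hh hy.
split; first exact: E1.
split.
- by apply: sphere_direction; rewrite -enormE exprn_gt0.
- rewrite /direction dotZr mulrC ler_pdivlMr//.
  by rewrite (_ : dot y z = rho * (q + lam) + dot y h)// zE !dotE z0y.
- rewrite /direction dotZr mulrC ltr_pdivrMr//.
  by apply: le_lt_trans Fp; rewrite zE !dotE pz0 ph.
Qed.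

(** By [cos_add_le], al^2 - q^2 is at least of order eps. A [lam] of order eps and a prism of width
    sqrt eps and thickness eps are then admissible in [direction_prism_cap], and [prism_volume] with
    s = sqrt eps gives the exponent. *)
Lemma cap_volume d (a : R) : 0 < a < pi / 2 ->
  exists2 c : R, 0 < c &
    forall (p y : 'rV[R]_d.+1) (eps : R), sphere p -> sphere y -> 0 < eps <= 1 ->
      0 <= dot p y <= cos (a + eps) ->
      ((c * Num.sqrt eps ^+ d.+1)%:E <=
        sphere_prob (lune p y (cos (2 * a))))%E.
Proof.
move=> a0pi; have /andP[a0 api] := a0pi.
set al := cos a.
have al0 : 0 < al by apply: cos_gt0_pihalf; apply/andP; split; lra.
have sa0 : 0 < sin a by exact: sin_gt0_pihalf.
have be0 : 0 < 1 - al ^+ 2 by rewrite -sin2cos2 exprn_gt0.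
have al1 : al < 1 by nra.
have k0 : 0 < sin a * cos 1 by rewrite mulr_gt0// cos1_gt0.
have k1 : sin a * cos 1 <= 1.
  by apply: mulr_ile1; rewrite ?sin_le1 ?cos_le1 ?(ltW sa0) ?(ltW (cos1_gt0 _)).
set k := sin a * cos 1 in k0 k1.
(* Small enough for lam = l eps to satisfy lam <= 1 - al^2 and, as al - q >= k eps, also 4 lam <=
   al^2 - q^2. *)
pose l := k * al * (1 - al ^+ 2) / 4.
have l0 : 0 < l by apply: divr_gt0 => //; apply: mulr_gt0 => //; exact: mulr_gt0.
pose m : R := d.+1%:R.
have m0 : 0 < m by rewrite ltr0n.
(* mu eps is the slack g for this lam; [c2] and mu / 64 turn the bounds g / 128 and g / 64 into
   equalities. *)
pose mu := l * (1 - al ^+ 2) / 2.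
have mu0 : 0 < mu by apply: divr_gt0 => //; exact: mulr_gt0.
pose c2 := Num.sqrt (mu / (128 * m)).
have c20 : 0 < c2 by rewrite sqrtr_gt0 divr_gt0// mulr_gt0.
have c30 : 0 < mu / 64 by rewrite divr_gt0.
have r0 : 0 < (8 * m)^-1 by rewrite invr_gt0 mulr_gt0.
have [c c0 hc] := prism_volume d r0 c20 c30.
exists (2 ^- d.+1 * c); first by rewrite mulr_gt0// invr_gt0 exprn_gt0.
move=> p y eps p1 y1 eps01 /andP[q0 qe]; have /andP[e0 e1] := eps01.
set q := dot p y in q0 qe *.
pose lam := l * eps.
have lam0 : 0 < lam by rewrite mulr_gt0.
pose z0 : 'rV[R]_d.+1 := (2 * q + lam) *: y - p.
set s := Num.sqrt eps.
have s0 : 0 < s by rewrite sqrtr_gt0.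
have s1 : s <= 1 by rewrite -[leRHS]sqrtr1 ler_sqrt.
have sE : s ^+ 2 = eps by rewrite sqr_sqrtr// ltW.
have -> : cos (2 * a) = 2 * al ^+ 2 - 1 by rewrite mulr_natl cos_mulr2n mulr_natl.
have qk : q <= al - k * eps by apply: le_trans qe _; exact: cos_add_le.
have ke0 : 0 < k * eps by rewrite mulr_gt0.
have kal : k * al <= 1 by apply: mulr_ile1 => //; exact: ltW.
have lb : l <= (1 - al ^+ 2) / 4 by rewrite /l ler_pM2r//; apply: ler_piMl => //; exact: ltW.
have lk : l <= k * al / 4.
  rewrite /l ler_pM2r//; apply: ler_piMr; first by apply: mulr_ge0; exact: ltW.
  by have := sqr_ge0 al; lra.
have laml : lam <= l by rewrite /lam ler_piMr// ltW.
have al2 := sqr_ge0 al.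
have lamk : 4 * lam <= al ^+ 2 - q ^+ 2.
  have h1 : 4 * lam <= al * (k * eps).
    by have := ler_wpM2r (ltW e0) lk; rewrite /lam; lra.
  have h2 : al * (k * eps) <= al * (al - q) by rewrite ler_pM2l//; lra.
  have h3 : 0 <= q * (al - q) by rewrite mulr_ge0//; lra.
  by lra.
have zz0 : 0 < dot z0 z0.
  have /sphereP pp := p1; have /sphereP yy := y1.
  rewrite /z0 !dotE pp yy (dotC y p) -/q.
  by have := mulr_ge0 q0 (ltW lam0); have := sqr_ge0 lam; lra.
have /sphereP yy := y1.
have := hc z0 y s zz0 yy; rewrite s0 s1 => /(_ isT) vol.
(* The prism recentred at z0 / 4, which keeps its volume. *)
pose P := [set z | prism z0 y (8 * m)^-1 (c2 * s) (mu / 64 * s ^+ 2) (z + - (4^-1 *: z0))].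
apply: (@le_trans _ _ ((2 ^- d.+1)%:E * lebesgue_rV d.+1 P)%E).
  have -> : lebesgue_rV d.+1 P =
      lebesgue_rV d.+1 (prism z0 y (8 * m)^-1 (c2 * s) (mu / 64 * s ^+ 2)).
    exact: lebesgue_rV_shift (measurable_prism _ _ _ _ _).
  have h : (0 <= (2 ^- d.+1 : R)%:E)%E by rewrite lee_fin invr_ge0 exprn_ge0.
  by rewrite -(mulrA (2 ^- d.+1)) EFinM; exact: (lee_wpmul2l h vol).
have PD z : P z -> unit_ball z /\ lune p y (2 * al ^+ 2 - 1) (direction z).
  move=> Pz.
  have := @direction_prism_cap d p y (z + - (4^-1 *: z0)) lam al c2 (mu / 64) s p1 y1 q0.
  rewrite -/q -/z0 -/m addrCA subrr addr0; apply => //.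
  - by rewrite al1 ltW.
  - by rewrite lam0; lra.
  - by lra.
  - by rewrite mulr_ge0// ltW.
  - rewrite exprMn sE sqr_sqrtr; last by rewrite ltW// divr_gt0// mulr_gt0.
    rewrite le_eqVlt; apply/orP; left; apply/eqP.
    by rewrite /mu /lam; field; rewrite gt_eqF.
  - by rewrite sE /mu /lam le_eqVlt; apply/orP; left; apply/eqP; field.
apply: sphere_prob_ge.
- exact: measurable_lune.
- exact: measurable_preshift (measurable_prism _ _ _ _ _).
- by move=> z /PD[].
- by move=> z /PD[].
Qed.

End cap_volume.

(** * Additive gain from a point of the body far from p *)

Section gap.
Context {R : realType}.

Lemma powR_half_sqrt (x : R) n : 0 <= x -> x `^ (n%:R / 2) = Num.sqrt x ^+ n.
Proof.
by move=> x0; rewrite mulrC powRrM powR12_sqrt// powR_mulrn// sqrtr_ge0.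
Qed.

Lemma ball_orthogonal_meets n (p x : 'rV[R]_n) (K : set 'rV[R]_n) (a : R) :
  sphere p -> 0 < a < pi / 2 -> convex_body_around p K -> a <= inner_radius p K ->
  spherical_ball p (2 * a) x -> Defs.orthogonal (x - p) `&` K !=set0.
Proof.
move=> p1 a0pi Kp aK xB; have [x1 _] := xB.
have [y [xy yB]] := (meets_spherical_ball p1 x1 a0pi).2 xB.
by exists y; split=> //; exact: spherical_ball_sub_body yB.
Qed.

(** The set measured by [Utilde] contains B(p, 2a) because K contains B(p, a), and the lune of y by
    convexity. They are disjoint, as p.x < cos(2a) on the lune, so their measures add. *)
Lemma Utilde_gap d (a : R) : 0 < a < pi / 2 ->
  exists2 c : R, 0 < c &
    forall (p y : 'rV[R]_d.+1) (K : set 'rV[R]_d.+1) (eps : R), sphere p ->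
      convex_body_around p K -> a <= inner_radius p K -> 0 < eps <= 1 ->
      K y -> a + eps <= geodesic_dist p y ->
      (sphere_prob (spherical_ball p (2 * a)) + (c * Num.sqrt eps ^+ d.+1)%:E
        <= Utilde p K)%E.
Proof.
move=> a0pi; have [c c0 hc] := cap_volume d a0pi; exists c => //.
have /andP[a0 api] := a0pi; have pi0 := pi_gt0 R.
move=> p y K eps p1 Kp aK eps01 Ky ay; have /andP[e0 e1] := eps01.
have [[C [_ _ _ KE]] Kpp Khalf] := Kp.
have y1 : sphere y by move: Ky; rewrite KE => -[].
have /andP[py1 py2] := dot_sphere_itv p1 y1.
have py12 : -1 <= dot p y <= 1 by rewrite py1.
have py0 : 0 <= dot p y <= cos (a + eps).
  apply/andP; split.
    have := Khalf y Ky; rewrite spherical_ballE ?cos_pihalf//; first by case.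
    by apply/andP; split; lra.
  rewrite -[leLHS]acosK ?in_itv//= leNgt ltr_cos -?leNgt// in_itv/=.
    by rewrite acos_ge0// acos_lepi.
  by apply/andP; split; [lra|apply: le_trans ay _; exact: acos_lepi].
have mB : measurable (spherical_ball p (2 * a)).
  by apply: measurable_spherical_ball => //; apply/andP; split; lra.
have mD := measurable_lune p y (cos (2 * a)).
have BD : [disjoint spherical_ball p (2 * a) & lune p y (cos (2 * a))].
  apply/disj_setPS => x [+ [_ _ xp]].
  rewrite spherical_ballE//; last by apply/andP; split; lra.
  by move=> -[_ /=]; rewrite leNgt xp.
apply: (@le_trans _ _ (sphere_prob (spherical_ball p (2 * a) `|` lune p y (cos (2 * a))))).
  rewrite measureU//; last exact/disj_set2P.
  by apply: leeD => //; exact: hc.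
apply: Utilde_ge.
- exact: measurableU.
- by move=> x [[]|[]].
- move=> x [xB|[x1 xy _]]; first exact: ball_orthogonal_meets xB.
  by apply: convex_body_meets Ky _ => //; rewrite (dotC x).
Qed.

End gap.

(** * Sharp lower bound, equality case and stability estimate *)

Theorem theoremD (R : realType) (d : nat) (a : R)
    (hd : (2 <= d)%N) (ha : 0 < a < pi / 2) :
  (forall p : 'rV[R]_d.+1, sphere p ->
     Utilde p (spherical_ball p a) = sphere_prob (spherical_ball p (2 * a)) /\
     forall K : set 'rV[R]_d.+1,
       convex_body_around p K -> a <= inner_radius p K ->
       (Utilde p (spherical_ball p a) <= Utilde p K)%E /\
       (Utilde p K = Utilde p (spherical_ball p a) <-> K = spherical_ball p a))
  /\
  (exists2 beta : R, 0 < beta &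
     forall p : 'rV[R]_d.+1, sphere p ->
     forall (eps : R) (K : set 'rV[R]_d.+1),
       0 < eps <= 1 ->
       convex_body_around p K -> a <= inner_radius p K ->
       eps <= radius_gap p K ->
       ((1 + beta * eps `^ (d.+1%:R / 2))%:E * Utilde p (spherical_ball p a)
          <= Utilde p K)%E).
Proof.
have [c c0 gap] := Utilde_gap d ha; have /andP[a0 api] := ha.
have pi2 : 2 <= pi :> R := pi_ge2 R.
have mB p : sphere p -> measurable (@spherical_ball R d.+1 p (2 * a)).
  by move=> p1; apply: measurable_spherical_ball => //; apply/andP; split; lra.
have sfin p : sphere p -> sphere_prob (@spherical_ball R d.+1 p (2 * a)) \is a fin_num.
  by move=> /mB m; rewrite ge0_fin_numE// (le_lt_trans (probability_le1 _ m)) ?ltry.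
split.
  move=> p p1; rewrite Utilde_spherical_ball//; split=> // K Kp aK.
  have subK := spherical_ball_sub_body p1 ha Kp aK.
  split.
    apply: Utilde_ge; [exact: mB|by move=> x []|].
    by move=> x; exact: ball_orthogonal_meets.
  split => [UK|->]; last by rewrite Utilde_spherical_ball.
  apply/seteqP; split => // y Ky.
  have [[C [_ _ _ KE]] _ _] := Kp.
  have y1 : sphere y by move: Ky; rewrite KE => -[].
  split=> //; rewrite leNgt; apply/negP => ay.
  (* A point of K outside B(p, a) forces a strict gain, which contradicts equality because the
     measure of the ball is finite. *)
  pose eps := Num.min 1 (geodesic_dist p y - a).
  have e0 : 0 < eps by rewrite lt_min ltr01 subr_gt0.
  have := gap p y K eps p1 Kp aK; rewrite e0 ge_min lexx => /(_ isT Ky).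
  rewrite UK -lerBrDl ge_min lexx orbT => /(_ isT).
  rewrite leNgt lteDl; last exact: sfin.
  by rewrite lte_fin mulr_gt0// exprn_gt0// sqrtr_gt0.
(* The gain is applied with eps / 2 in place of eps, hence the power of sqrt(1/2). *)
exists (c * Num.sqrt 2^-1 ^+ d.+1).
  by rewrite mulr_gt0// exprn_gt0// sqrtr_gt0 invr_gt0.
move=> p p1 eps K /andP[e0 e1] Kp aK gapK.
(* Otherwise the outer radius is at most a + eps / 2 and the radius gap at most eps / 2. Halving eps
   avoids showing that the outer radius is attained. *)
have [y Ky ay] : exists2 y, K y & a + eps / 2 <= geodesic_dist p y.
  apply: contrapT => h.
  have : outer_radius p K <= a + eps / 2.
    apply: ge_inf; first by exists 0 => r [/andP[]].
    split; first by apply/andP; split; lra.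
    have [[C [_ _ _ KE]] _ _] := Kp.
    move=> y Ky; split; first by move: Ky; rewrite KE => -[].
    by rewrite leNgt; apply/negP => /ltW ay; apply: h; exists y.
  by move: gapK; rewrite /radius_gap; lra.
have e2 : 0 < eps / 2 <= 1 by apply/andP; split; lra.
apply: le_trans (gap p y K _ p1 Kp aK e2 Ky ay).
rewrite Utilde_spherical_ball// powR_half_sqrt; last exact: ltW.
rewrite [eps / 2]mulrC sqrtrM ?invr_ge0// exprMn mulrA.
set k := c * _ * _.
have k0 : 0 <= k.
  by rewrite /k !mulr_ge0 ?exprn_ge0 ?sqrtr_ge0// ltW.
(* The additive gain dominates the multiplicative one, since the ball has probability at most 1. *)
rewrite EFinD ge0_muleDl// mul1e leeD2l// muleC gee_pMl ?lee_fin//; first exact: sfin.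
by rewrite probability_le1//; exact: mB.
Qed.
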